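(* Let $n>3$ and $k\ge 2$ be integers, and let $P_n^{(0)}=(z_0^{(0)},\dots,z_{n-1}^{(0)})$ be a cyclic spheric $n$-polygon with circumscribed circle centered at $c$ and associated angle vector $\alpha^{(0)}=(\alpha_0^{(0)},\dots,\alpha_{n-1}^{(0)})\in\mathbb{R}^n$. Let $A=(a_{ij})$ be the circulant $n\times n$ matrix (indices $0,\dots,n-1$ modulo $n$) with $a_{i,i}=\frac{k-1}{k}$, $a_{i,i+1}=\frac1k$ and all other entries $0$. For $m\ge 0$ put $\alpha^{(m)}=A^m\alpha^{(0)}$, and let $P_n^{(m)}$ be the spheric $n$-polygon with angle vector $\alpha^{(m)}$ constructed around $c$. Then the sequence $P_n^{(m)}$ converges, as $m\to\infty$, to a regular $n$-polygon.
   Context: A spheric $n$-polygon is an $n$-tuple $(z_0,\dots,z_{n-1})$ of points of the unit sphere $\mathbb{S}^2\subset\mathbb{R}^3$, its vertices, counted counterclockwise. It is called cyclic if it has a circumscribed circle, i.e. all its vertices lie on one circle on the sphere; let $c\in\mathbb{S}^2$ be the center of this circle. For $j\in\mathbb{Z}/n\mathbb{Z}$, $\alpha_j$ is the angle at $c$ between the directions to $z_j$ and $z_{j+1}$, i.e. the angle of the counterclockwise rotation around the axis $c$ that takes $z_j$ to $z_{j+1}$; thus $\sum_{j=0}^{n-1}\alpha_j=2\pi$. The polygon $P_n^{(m)}$ with angle vector $\alpha^{(m)}$ constructed around $c$ has its $n$ vertices on the circle on the sphere around $c$ of radius $\|c-z_j^{(0)}\|$ (the circumscribed circle of $P_n^{(0)}$),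 with consecutive angles $\alpha^{(m)}_0,\dots,\alpha^{(m)}_{n-1}$ around $c$. (The transformation $\alpha\mapsto A\alpha$, that is $\alpha_j\mapsto\frac{k-1}{k}\alpha_j+\frac1k\alpha_{j+1}$, is the one induced on angles by rotating each vertex $z_j$ around $c$ by $\alpha_j/k$.) A sequence of such polygons converges to a regular polygon if its associated angle vectors in $\mathbb{R}^n$ converge to $(\frac{2\pi}{n},\dots,\frac{2\pi}{n})$ in the Euclidean norm of $\mathbb{R}^n$. *)

(* Defs.v *)
From HB Require Import structures.
From mathcomp Require Import all_boot all_order all_algebra.
From mathcomp Require Import all_classical all_reals all_analysis.

Set Implicit Arguments.
Unset Strict Implicit.
Unset Printing Implicit Defensive.

Import Order.TTheory GRing.Theory Num.Theory.
Import numFieldNormedType.Exports.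

Local Open Scope classical_set_scope.
Local Open Scope ring_scope.

(* The norm that the library puts on matrices is the sup norm, hence this one. *)
Definition enorm (R : realType) (n : nat) (v : 'cV[R]_n) : R :=
  Num.sqrt (\sum_i v i 0 ^+ 2).

Definition dotprod (R : realType) (n : nat) (u v : 'cV[R]_n) : R :=
  \sum_i u i 0 * v i 0.

(* Indices are added modulo 3, in the ring 'I_3. *)
Definition crossprod (R : realType) (u v : 'cV[R]_3) : 'cV[R]_3 :=
  \col_i (u (i + 1) 0 * v (i + 2) 0 - u (i + 2) 0 * v (i + 1) 0).

(* Rodrigues' formula for the rotation of angle t around the axis directed by
   the unit vector c, counterclockwise when seen from the tip of c. *)
Definition rotation (R : realType) (c : 'cV[R]_3) (t : R) (v : 'cV[R]_3) :
    'cV[R]_3 :=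
  cos t *: v + sin t *: crossprod c v + ((1 - cos t) * dotprod c v) *: c.

Definition sphere (R : realType) : set 'cV[R]_3 := [set z | enorm z = 1].

(* The radius is the Euclidean distance in the ambient space, so that the
   circles not reduced to a point are those with 0 < r < 2. *)
Definition circle (R : realType) (c : 'cV[R]_3) (r : R) : set 'cV[R]_3 :=
  [set z | sphere z /\ enorm (c - z) = r].

(* If z and w lie on a common circle around c not reduced to a point, there is
   exactly one such t; the default value 0 is then irrelevant. *)
Definition ccw_angle (R : realType) (c z w : 'cV[R]_3) : R :=
  xget 0 [set t : R | 0 <= t < 2 * pi /\ rotation c t z = w].

(* ordS is the successor modulo n. *)
Definition angle_vector (R : realType) (n : nat) (c : 'cV[R]_3)
    (z : 'I_n -> 'cV[R]_3) : 'cV[R]_n :=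
  \col_j ccw_angle c (z j) (z (ordS j)).

(* The vertices are counted counterclockwise around c when the successive
   counterclockwise angles add up to exactly one turn. This also selects c
   among the two antipodal centers of the circle. *)
Definition cyclic_polygon (R : realType) (n : nat) (c : 'cV[R]_3) (r : R)
    (z : 'I_n -> 'cV[R]_3) : Prop :=
  [/\ sphere c, 0 < r < 2, forall j, circle c r (z j)
    & \sum_j angle_vector c z j 0 = 2 * pi].

Definition polygon_around (R : realType) (n : nat) (c : 'cV[R]_3) (r : R)
    (alpha : 'cV[R]_n) (z : 'I_n -> 'cV[R]_3) : Prop :=
  (forall j, circle c r (z j)) /\ angle_vector c z = alpha.

Definition circulant_mx (R : realType) (n k : nat) : 'M[R]_n :=
  \matrix_(i, j) if j == i then (k%:R - 1) / k%:R
                 else if j == ordS i then 1 / k%:R else 0.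

Definition cvg_to_regular (R : realType) (n : nat) (c : 'cV[R]_3)
    (P : nat -> 'I_n -> 'cV[R]_3) : Prop :=
  enorm (angle_vector c (P m) - const_mx (2 * pi / n%:R)) @[m --> \oo] --> 0.

(* Main.v *)
(* With p = 1/k, one step of the iteration is x_j <- (1 - p) x_j + p x_{j+1}.
   It preserves the sum of the x_j and lowers their sum of squares by
   p (1 - p) \sum_j (x_{j+1} - x_j)^2. The sum of squares being bounded below,
   the gaps x_{j+1} - x_j tend to 0, so every x_j tends to the mean 2 pi / n.
   The averages also stay in [0, 2 pi[, so turning a vertex of the initial
   polygon around c by the partial sums of the angles gives a polygon: it
   closes up because the angles add up to 2 pi, and its angles are the
   prescribed ones because the rotations by t in [0, 2 pi[ move a point other
   than c and - c to distinct points. *)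

Require Import Defs.
From HB Require Import structures.
From mathcomp Require Import all_boot all_order all_algebra.
From mathcomp Require Import all_classical all_reals all_analysis.
From mathcomp Require Import ring lra.

Set Implicit Arguments.
Unset Strict Implicit.
Unset Printing Implicit Defensive.

Import Order.TTheory GRing.Theory Num.Theory.
Import numFieldNormedType.Exports.

Local Open Scope classical_set_scope.
Local Open Scope ring_scope.


(** * Dot products, cross products and rotations in three-space *)

Section Rotations.
Variable R : realType.
Implicit Types (c u v w z : 'cV[R]_3) (s t a r : R).

Lemma dotprodC n (u v : 'cV[R]_n) : dotprod u v = dotprod v u.
Proof. by apply: eq_bigr => i _; rewrite mulrC. Qed.

Lemma dotprodDr n (u v w : 'cV[R]_n) :
  dotprod u (v + w) = dotprod u v + dotprod u w.
Proof. by rewrite -big_split; apply: eq_bigr => i _; rewrite mxE mulrDr. Qed.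

Lemma dotprodZr n a (u v : 'cV[R]_n) : dotprod u (a *: v) = a * dotprod u v.
Proof. by rewrite mulr_sumr; apply: eq_bigr => i _; rewrite mxE mulrCA. Qed.

Lemma dotprodDl n (u v w : 'cV[R]_n) :
  dotprod (v + w) u = dotprod v u + dotprod w u.
Proof. by rewrite dotprodC dotprodDr !(dotprodC u). Qed.

Lemma dotprodZl n a (u v : 'cV[R]_n) : dotprod (a *: v) u = a * dotprod v u.
Proof. by rewrite dotprodC dotprodZr (dotprodC u). Qed.

Lemma enormE n (u : 'cV[R]_n) : enorm u = Num.sqrt (dotprod u u).
Proof. by congr Num.sqrt; apply: eq_bigr => i _; rewrite expr2. Qed.

Lemma enorm_sqr n (u : 'cV[R]_n) : enorm u ^+ 2 = dotprod u u.
Proof.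
by rewrite enormE sqr_sqrtr //; apply: sumr_ge0 => i _; rewrite -expr2 sqr_ge0.
Qed.

Lemma enorm_subr_sqr n (u v : 'cV[R]_n) :
  enorm (u - v) ^+ 2 = dotprod u u - 2 * dotprod u v + dotprod v v.
Proof.
rewrite enorm_sqr -scaleN1r !(dotprodDl, dotprodDr, dotprodZl, dotprodZr).
by rewrite (dotprodC v u); ring.
Qed.

Lemma crossprodDr c v w : crossprod c (v + w) = crossprod c v + crossprod c w.
Proof. by apply/matrixP => i j; rewrite !mxE; ring. Qed.

Lemma crossprodZr a c v : crossprod c (a *: v) = a *: crossprod c v.
Proof. by apply/matrixP => i j; rewrite !mxE; ring. Qed.

Lemma crossprodvv c : crossprod c c = 0.
Proof. by apply/matrixP => i j; rewrite !mxE; ring. Qed.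

(** With [crossprod3] and [col3P], this turns vector identities into polynomial ones in the
    coordinates, which [ring] decides. *)
Lemma dotprod3 u v : dotprod u v =
  u 0 0 * v 0 0 + u 1 0 * v 1 0 + u 2 0 * v 2 0.
Proof.
rewrite /dotprod !big_ord_recr big_ord0 /= add0r.
by congr (_ * _ + _ * _ + _ * _); congr (_ _ 0); apply/val_inj.
Qed.

Lemma crossprod3 u v : (crossprod u v 0 0 = u 1 0 * v 2 0 - u 2 0 * v 1 0) *
  (crossprod u v 1 0 = u 2 0 * v 0 0 - u 0 0 * v 2 0) *
  (crossprod u v 2 0 = u 0 0 * v 1 0 - u 1 0 * v 0 0).
Proof.
by do !split; rewrite mxE; congr (_ * _ - _ * _); congr (_ _ 0); apply/val_inj.
Qed.

Lemma col3P u v : u 0 0 = v 0 0 -> u 1 0 = v 1 0 -> u 2 0 = v 2 0 -> u = v.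
Proof.
move=> e0 e1 e2; apply/matrixP => i j; rewrite ord1.
by case: i => [[|[|[|//]]] ilt]; [move: e0|move: e1|move: e2];
  congr (u _ 0 = v _ 0); apply/val_inj.
Qed.

Lemma dotprod_crossl c v : dotprod c (crossprod c v) = 0.
Proof. by rewrite dotprod3 !crossprod3; ring. Qed.

Lemma dotprod_crossr c v : dotprod v (crossprod c v) = 0.
Proof. by rewrite dotprod3 !crossprod3; ring. Qed.

(** Lagrange's identity; for a unit [c] the value is the squared distance from [v] to the axis. *)
Lemma dotprod_cross c v : dotprod (crossprod c v) (crossprod c v) =
  dotprod c c * dotprod v v - dotprod c v ^+ 2.
Proof. by rewrite !dotprod3 !crossprod3; ring. Qed.

Lemma crossprod_cross c v :
  crossprod c (crossprod c v) = dotprod c v *: c - dotprod c c *: v.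
Proof. by apply: col3P; rewrite !(crossprod3, mxE) !dotprod3; ring. Qed.

Section UnitAxis.
Variable c : 'cV[R]_3.
Hypothesis c1 : dotprod c c = 1.

Lemma dotprod_rotation t v : dotprod c (rotation c t v) = dotprod c v.
Proof. by rewrite !(dotprodDr, dotprodZr) dotprod_crossl c1; ring. Qed.

Lemma crossprod_rotation t v : crossprod c (rotation c t v) =
  cos t *: crossprod c v + sin t *: (dotprod c v *: c - v).
Proof.
by rewrite !(crossprodDr, crossprodZr) crossprodvv crossprod_cross c1 scaler0
  scale1r addr0.
Qed.

(** For a unit [c], [crossprod c] is a quarter turn on the plane orthogonal to [c], so the addition
    formulas of [cos] and [sin] give the composition. *)
Lemma rotationD s t v : rotation c s (rotation c t v) = rotation c (s + t) v.
Proof.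
rewrite {1}/rotation crossprod_rotation dotprod_rotation /rotation cosD sinD.
move: (crossprod c v) (dotprod c v) => w d.
by apply/matrixP => i j; rewrite !mxE; ring.
Qed.

Lemma rotation0 v : rotation c 0 v = v.
Proof. by rewrite /rotation cos0 sin0 subrr mul0r !scale0r scale1r !addr0. Qed.

Lemma rotation2pi v : rotation c (2 * pi) v = v.
Proof.
have e : 2 * pi = pi *+ 2 :> R by rewrite mulr_natl.
by rewrite /rotation e cos2pi sin2pi subrr mul0r !scale0r scale1r !addr0.
Qed.

Lemma dotprod_rotation2 t v :
  dotprod (rotation c t v) (rotation c t v) = dotprod v v.
Proof.
rewrite !(dotprodDr, dotprodZr) !(dotprodDl, dotprodZl).
rewrite dotprod_crossl dotprod_cross (dotprodC (crossprod c v) v).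
rewrite dotprod_crossr (dotprodC (crossprod c v) c) dotprod_crossl.
rewrite (dotprodC v c) c1.
by have := sin2cos2 t; move: (cos t) (sin t) => C S SE; ring: SE.
Qed.

(** This and [dotprod_cross_rotation] recover [cos t] and [sin t] from the rotated vector when [v]
    is off the axis. *)
Lemma dotprod_rotationr t v : dotprod v (rotation c t v) =
  cos t * (dotprod v v - dotprod c v ^+ 2) + dotprod c v ^+ 2.
Proof.
rewrite !(dotprodDr, dotprodZr) dotprod_crossr (dotprodC v c).
by ring.
Qed.

Lemma dotprod_cross_rotation t v : dotprod (crossprod c v) (rotation c t v) =
  sin t * (dotprod v v - dotprod c v ^+ 2).
Proof.
rewrite !(dotprodDr, dotprodZr) dotprod_cross c1.
rewrite (dotprodC _ v) dotprod_crossr (dotprodC _ c) dotprod_crossl.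
by ring.
Qed.

Lemma circle_rotation r t z : circle c r z -> circle c r (rotation c t z).
Proof.
move=> [z1 zr]; split.
  by rewrite /sphere /= enormE dotprod_rotation2 -enormE.
rewrite -zr; apply: (@pexpIrn _ 2); rewrite ?nnegrE ?sqrtr_ge0 //.
by rewrite !enorm_subr_sqr dotprod_rotation dotprod_rotation2.
Qed.

(** The squared distance from [c] to [z] is [2 - 2 * dotprod c z], so [0 < r < 2] keeps [z] away
    from [c] and [- c]. *)
Lemma circle_dotprod_lt1 r z : 0 < r < 2 -> circle c r z ->
  dotprod z z = 1 /\ dotprod c z ^+ 2 < 1.
Proof.
move=> /andP[r0 r2] [z1 zr].
have zz1 : dotprod z z = 1 by rewrite -enorm_sqr z1 expr1n.
split=> //; have := enorm_subr_sqr c z; rewrite zr zz1 c1.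
move: (dotprod c z) => d rd.
have [d1 dN1] : d < 1 /\ -1 < d by split; nra.
by nra.
Qed.

End UnitAxis.

(** * Counterclockwise angles and construction of a polygon from its angles *)

Lemma cos_eq1 t : - (2 * pi) < t < 2 * pi -> cos t = 1 -> t = 0.
Proof.
wlog t_ge0 : t / 0 <= t => [hw|].
  have [t0|t0] := leP 0 t; first exact: hw.
  move=> /andP[t1 t2] ct; apply/eqP; rewrite -oppr_eq0; apply/eqP.
  by apply: hw; [lra|lra|rewrite cosN].
move=> /andP[_ t2] ct; apply/eqP; apply: contraT => tn0.
have tgt0 : 0 < t by rewrite lt_def tn0.
(* Half-angle formula: [cos t = 1] would force [sin (t / 2)] to vanish. *)
have : 0 < sin (t / 2) by apply: sin_gt0_pi; lra.
have : cos (t / 2 *+ 2) = 1 by rewrite -mulr_natr divfK.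
by rewrite cos_mulr2n cos2sin2 mulr2n => h1 h2; nra.
Qed.

Lemma rotation_inj c r z s t : dotprod c c = 1 -> 0 < r < 2 -> circle c r z ->
  0 <= s < 2 * pi -> 0 <= t < 2 * pi ->
  rotation c s z = rotation c t z -> s = t.
Proof.
move=> c1 r02 /(circle_dotprod_lt1 c1 r02)[z1 d1] /andP[s0 s2] /andP[t0 t2] e.
have d0 : 1 - dotprod c z ^+ 2 != 0 by rewrite subr_eq0 gt_eqF.
have ec : cos s = cos t.
  have := dotprod_rotationr c t z; rewrite -e dotprod_rotationr z1.
  by move/addIr/(mulIf d0).
have es : sin s = sin t.
  have := dotprod_cross_rotation c1 t z; rewrite -e dotprod_cross_rotation //.
  by rewrite z1 => /(mulIf d0).
(* The difference [s - t] lies strictly between [- (2 * pi)] and [2 * pi], and its cosine is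
   [cos t ^+ 2 + sin t ^+ 2]. *)
apply/eqP; rewrite -subr_eq0; apply/eqP; apply: cos_eq1; first by lra.
by rewrite cosB ec es -!expr2 cos2Dsin2.
Qed.

(** By [rotation_inj] the set searched by [xget] has at most one element, and [t] is in it. *)
Lemma ccw_angle_rotation c r z t : dotprod c c = 1 -> 0 < r < 2 ->
  circle c r z -> 0 <= t < 2 * pi -> ccw_angle c z (rotation c t z) = t.
Proof.
move=> c1 r02 zr t02; apply: xget_subset1 => //= a b [a02 ea] [b02 eb].
by apply: (rotation_inj c1 r02 zr) => //; rewrite ea eb.
Qed.

Lemma ccw_angle_itv c z w : 0 <= ccw_angle c z w < 2 * pi.
Proof.
rewrite /ccw_angle; case: xgetP => [t _ []//|_].
(* The default value 0 of [xget] lies in the interval too. *)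
by rewrite lexx mulr_gt0 // pi_gt0.
Qed.

Lemma exists_polygon_around n c r (a : 'cV[R]_n.+1) z0 :
  dotprod c c = 1 -> 0 < r < 2 -> circle c r z0 ->
  (forall j, 0 <= a j 0 < 2 * pi) -> \sum_j a j 0 = 2 * pi ->
  exists z : 'I_n.+1 -> 'cV[R]_3, polygon_around c r a z.
Proof.
move=> c1 r02 cz0 a02 asum.
(* Extending [a] to natural indices allows partial sums over [0 <= i < j]. *)
pose b i := a (inord i) 0.
have bE (j : 'I_n.+1) : b j = a j 0 by rewrite /b inord_val.
exists (fun j : 'I_n.+1 => rotation c (\sum_(0 <= i < j) b i) z0).
split=> [j|]; first exact: circle_rotation.
apply/matrixP => j l; rewrite ord1 mxE {l}.
rewrite -[in RHS](ccw_angle_rotation c1 r02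
  (circle_rotation c1 (\sum_(0 <= i < j) b i) cz0) (a02 j)).
congr ccw_angle; rewrite rotationD // -bE addrC -big_nat_recr //=.
(* At the last index [ordS] wraps to 0: the empty partial sum there must match the full turn
   [2 * pi]. *)
have [jn|jn] := ltnP j.+1 n.+1; first by rewrite modn_small.
have -> : j.+1 = n.+1 by apply/anti_leq; rewrite jn (ltn_ord j).
rewrite modnn big_nil rotation0 big_mkord (eq_bigr _ (fun i _ => bE i)) asum.
by rewrite rotation2pi.
Qed.

End Rotations.

(** * Convergence of cyclic averaging *)

Lemma cvg_sum0 (R : realType) n (f : nat -> 'I_n -> R) :
  (forall j, f m j @[m --> \oo] --> 0) -> \sum_j f m j @[m --> \oo] --> 0.
Proof.
move=> f0; have := cvg_big (x0 := 0) (r := index_enum 'I_n)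
  (@add_continuous R) _ (fun j (_ : xpredT j) => f0 j).
by rewrite big1_eq; apply.
Qed.

Section CyclicAveraging.
Variables (R : realType) (n : nat).
Implicit Types (p : R) (y : 'I_n -> R).

Lemma sum_ordS y : \sum_j y (ordS j) = \sum_j y j.
Proof. by rewrite [RHS](reindex_inj (@ordS_inj n)). Qed.

Lemma sum_averaging p y :
  \sum_j ((1 - p) * y j + p * y (ordS j)) = \sum_j y j.
Proof. by rewrite big_split /= -!mulr_sumr (sum_ordS y); ring. Qed.

(** Termwise, the square of the average is the average of the squares minus [p * (1 - p)] times the
    squared gap. *)
Lemma sum_sqr_averaging p y :
  \sum_j ((1 - p) * y j + p * y (ordS j)) ^+ 2 =
  \sum_j y j ^+ 2 - p * (1 - p) * \sum_j (y (ordS j) - y j) ^+ 2.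
Proof.
rewrite -(sum_averaging p (fun j => y j ^+ 2)) mulr_sumr -sumrB.
by apply: eq_bigr => j _; ring.
Qed.

Lemma iter_ordS_val l (j : 'I_n) : iter l (@ordS n) j = ((j + l) %% n)%N :> nat.
Proof.
elim: l => [|l IHl] /=; first by rewrite addn0 modn_small.
by rewrite IHl -addn1 modnDml addn1 addnS.
Qed.

Lemma iter_ordS_onto (i j : 'I_n) : exists l, i = iter l (@ordS n) j.
Proof.
(* Adding [n] first keeps the subtraction from truncating. *)
exists (i + n - j)%N; apply/val_inj; rewrite /= iter_ordS_val subnKC.
  by rewrite modnDr modn_small.
by rewrite (leq_trans (ltnW (ltn_ord j))) ?leq_addl.
Qed.

Variables (p : R) (x : nat -> 'I_n -> R).
Hypotheses (p01 : 0 < p < 1)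
  (xS : forall m j, x m.+1 j = (1 - p) * x m j + p * x m (ordS j)).

Lemma sum_averaging_iter m : \sum_j x m j = \sum_j x 0 j.
Proof.
elim: m => // m <-; rewrite -(sum_averaging p (x m)).
by apply: eq_bigr => j _; rewrite xS.
Qed.

Lemma averaging_itv a b : (forall j, a <= x 0 j < b) ->
  forall m j, a <= x m j < b.
Proof.
move=> x0ab; elim=> // m IHm j; rewrite xS.
by have := IHm j; have := IHm (ordS j); move: p01; nra.
Qed.

Lemma cvg_averaging_step j : x m (ordS j) - x m j @[m --> \oo] --> 0.
Proof.
pose E m := \sum_j x m j ^+ 2.
pose D m := \sum_j (x m (ordS j) - x m j) ^+ 2.
have [p0 p1] := andP p01.
have q0 : 0 < p * (1 - p) by rewrite mulr_gt0 // subr_gt0.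
have D0 m : 0 <= D m by apply: sumr_ge0 => i _; exact: sqr_ge0.
have ES m : E m.+1 = E m - p * (1 - p) * D m.
  by rewrite -sum_sqr_averaging; apply: eq_bigr => i _; rewrite xS.
have cE : cvgn E.
  apply: nonincreasing_is_cvgn.
    apply/nonincreasing_seqP => m.
    by rewrite ES lerBlDr lerDl mulr_ge0 // ltW.
  by exists 0 => _ [m _ <-]; apply: sumr_ge0 => i _; exact: sqr_ge0.
have cD : D m @[m --> \oo] --> 0.
  (* [D] is proportional to the decrement of the convergent sequence [E]. *)
  have -> : D = fun m => (p * (1 - p))^-1 * (E m - E m.+1).
    by apply/funext => m; rewrite ES subKr mulKf // gt_eqF.
  rewrite -[0](mulr0 (p * (1 - p))^-1) -(subrr (limn E)).
  apply: cvgM; first exact: cvg_cst.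
  by apply: cvgB => //; rewrite (cvg_shiftS E).
apply: norm_cvg0.
(* Each gap is bounded in absolute value by the square root of the sum [D] of all squared gaps. *)
apply: (squeeze_cvgr (f := cst 0) (h := fun m => Num.sqrt (D m))).
- near=> m; rewrite normr_ge0 /= -sqrtr_sqr ler_wsqrtr //.
  rewrite /D (bigD1 j) //= lerDl sumr_ge0 // => i _; exact: sqr_ge0.
- exact: cvg_cst.
- by rewrite -[0]sqrtr0; apply: continuous_cvg => //; exact: sqrt_continuous.
Unshelve. all: by end_near.
Qed.

(** The index [i] is reached from [j] by finitely many successors, and the gaps telescope. *)
Lemma cvg_averaging_gap i j : x m i - x m j @[m --> \oo] --> 0.
Proof.
have [l ->] := iter_ordS_onto i j; elim: l => [|l IHl] /=.
  by under eq_fun do rewrite subrr; exact: cvg_cst.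
under eq_fun => m do rewrite -(subrKA (x m (iter l (@ordS n) j))).
by rewrite -[0]addr0; apply: cvgD => //; exact: cvg_averaging_step.
Qed.

Lemma cvg_averaging j : x m j @[m --> \oo] --> (\sum_i x 0 i) / n%:R.
Proof.
(* The index [j] itself shows that ['I_n] is inhabited. *)
have n0 : n%:R != 0 :> R by rewrite pnatr_eq0; case: {+}n j => [[]|].
(* Each entry is the invariant mean plus the average of its differences to all entries. *)
have -> : (fun m => x m j) = fun m =>
    (\sum_i x 0 i) / n%:R + n%:R^-1 * \sum_i (x m j - x m i).
  apply/funext => m; rewrite sumrB sum_averaging_iter sumr_const card_ord.
  by rewrite -mulr_natl; field.
rewrite -[X in _ --> X]addr0; apply: cvgD; first exact: cvg_cst.
rewrite -[X in _ --> X](mulr0 n%:R^-1); apply: cvgM; first exact: cvg_cst.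
by apply: cvg_sum0 => i; exact: cvg_averaging_gap.
Qed.

End CyclicAveraging.

(** * Euclidean norm, circulant matrix and conclusion *)

Lemma cvg_enorm (R : realType) n (v : nat -> 'cV[R]_n) (l : 'cV[R]_n) :
  (forall j, v m j 0 @[m --> \oo] --> l j 0) ->
  enorm (v m - l) @[m --> \oo] --> 0.
Proof.
move=> vl; rewrite -[X in _ --> X]sqrtr0 /enorm.
apply: continuous_cvg; first exact: sqrt_continuous.
apply: cvg_sum0 => j.
have vl0 : v m j 0 - l j 0 @[m --> \oo] --> 0.
  by rewrite -(subrr (l j 0)); apply: cvgB => //; exact: cvg_cst.
under eq_fun do rewrite !mxE.
by have := cvgM vl0 vl0; rewrite mulr0; apply.
Qed.

(** Puts the two nonzero entries of a row of [circulant_mx] in distinct columns. *)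
Lemma ordS_neq n (j : 'I_n) : (1 < n)%N -> ordS j != j.
Proof.
move=> n1; apply/eqP => /(congr1 val)/=.
have [jn|jn] := ltnP j.+1 n.
  by rewrite modn_small // => /eqP; rewrite -{2}(addn0 j) -addn1 eqn_add2l.
have jE : j.+1 = n by apply/anti_leq; rewrite jn (ltn_ord j).
by rewrite jE modnn => j0; move: n1; rewrite -jE -j0.
Qed.

Lemma circulant_mxE (R : realType) n k (v : 'cV[R]_n) j :
  (1 < n)%N -> (0 < k)%N ->
  (circulant_mx R n k *m v) j 0 =
  (1 - k%:R^-1) * v j 0 + k%:R^-1 * v (ordS j) 0.
Proof.
move=> n1 k0; have k0' : k%:R != 0 :> R by rewrite pnatr_eq0 -lt0n.
rewrite mxE (bigD1 j) //= (bigD1 (ordS j)) ?ordS_neq //= big1 => [|i].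
  by rewrite !mxE !eqxx (negbTE (ordS_neq _ n1)) addr0; field.
by rewrite mxE => /andP[/negbTE -> /negbTE ->]; rewrite mul0r.
Qed.

Theorem theorem5 (R : realType) (n k : nat) (c : 'cV[R]_3) (r : R)
    (P0 : 'I_n -> 'cV[R]_3) (hn : (3 < n)%N) (hk : (2 <= k)%N)
    (hP0 : cyclic_polygon c r P0) :
  let alpha := fun m : nat => circulant_mx R n k ^+ m *m angle_vector c P0 in
  (forall m, exists z : 'I_n -> 'cV[R]_3, polygon_around c r (alpha m) z) /\
  (forall P : nat -> 'I_n -> 'cV[R]_3,
     (forall m, polygon_around c r (alpha m) (P m)) -> cvg_to_regular c P).
Proof.
move=> alpha.
have [c1 r02 P0c P0sum] := hP0.
have cc1 : dotprod c c = 1 by rewrite -enorm_sqr c1 expr1n.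
have k0 : (0 < k)%N by exact: ltnW.
(* [hk] makes [1/k] strictly less than 1; for [k = 1] the step would only shift the angles. *)
have p01 : 0 < (k%:R^-1 : R) < 1.
  by rewrite invr_gt0 ltr0n k0 invf_lt1 ?ltr0n // ltr1n.
have alphaS m j : alpha m.+1 j 0 =
    (1 - k%:R^-1) * alpha m j 0 + k%:R^-1 * alpha m (ordS j) 0.
  by rewrite /alpha exprS -mulmxE -mulmxA circulant_mxE // (ltn_trans _ hn).
have alpha0 : alpha 0 = angle_vector c P0 by rewrite /alpha expr0 mul1mx.
split=> [m|P Palpha].
  have alpha0_itv j : 0 <= alpha 0 j 0 < 2 * pi.
    by rewrite alpha0 mxE ccw_angle_itv.
  have := averaging_itv p01 alphaS alpha0_itv m.
  have := sum_averaging_iter alphaS m.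
  rewrite alpha0 P0sum; move: (alpha m).
  (* Exposing [n] as a successor provides vertex 0 of [P0], the starting point of the
     construction. *)
  case: n hn P0 P0c {hP0 P0sum alpha alphaS alpha0 alpha0_itv} => // n' _ z zc a.
  by move=> asum a02; apply: exists_polygon_around (zc ord0) a02 asum.
rewrite /cvg_to_regular; apply: cvg_enorm => j.
under eq_fun do rewrite (Palpha _).2.
by rewrite mxE -P0sum -alpha0; exact: cvg_averaging p01 alphaS j.
Qed.
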